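(* Let $n\ge 2$, let $a_1,\dots,a_n$ and $c_1,\dots,c_n$ be natural numbers (positive integers), and let $b$ be a non-negative integer. Let $M$ be the least common multiple of $a_1,\dots,a_n$, let $r\in\{0,1,\dots,M-1\}$ be the remainder of $b$ modulo $M$, and let $$\overline{s}=\left\lfloor \sum_{i=1}^{n} c_i-\frac{\sum_{i=1}^{n} a_i+r}{M}\right\rfloor .$$ Put $m_0=P(r)$ and, for $k=1,2,\dots,\overline{s}$, $$m_k=P(r+kM)-\sum_{i=1}^{n}P(r+kM-Mc_i)+\sum_{1\le i<j\le n}P(r+kM-M(c_i+c_j))-\cdots+(-1)^k\sum_{1\le i_1<i_2<\cdots<i_k\le n}P(r+kM-M(c_{i_1}+c_{i_2}+\cdots+c_{i_k})),$$ i.e. $m_k=\sum_{j=0}^{k}(-1)^j\sum_{1\le i_1<\cdots<i_j\le n}P\bigl(r+kM-M(c_{i_1}+\cdots+c_{i_j})\bigr)$. Then $$P\Bigl(\sum_{i=1}^{n}a_ix_i=b\Bigr)=\sum_{k=0}^{\overline{s}}m_k\,P\Bigl(\sum_{i=1}^{n}c_ix_i=\left\lfloor\frac{b}{M}\right\rfloor-k\Bigr).$$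
   Context: For natural numbers $e_1,\dots,e_n$ and an integer $l$, $P(\sum_{i=1}^n e_ix_i=l)$ denotes the number of $n$-tuples $(x_1,\dots,x_n)$ of non-negative integers with $\sum_{i=1}^n e_ix_i=l$ (so it is $0$ for $l<0$). For an integer $l$, $P(l)$ abbreviates $P(\sum_{i=1}^n a_ix_i=l)$. Empty sums are $0$ (in particular, a sum over $i_1<\cdots<i_j$ with $j>n$ is $0$, and a sum from $k=0$ to a negative number is $0$). *)

(* Defs.v *)
From mathcomp Require Import all_boot all_order all_algebra.

Set Implicit Arguments.
Unset Strict Implicit.
Unset Printing Implicit Defensive.

Import Order.TTheory GRing.Theory Num.Theory.
Local Open Scope ring_scope.

(* The number of n-tuples of non-negative integers with
   \sum_i e_i x_i = l, for positive e_i.  Each coordinate of a solution is then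
   at most l, so only tuples with coordinates in {0, ..., |l|} are enumerated;
   nsolP shows that no solution is lost. *)
Definition nsol (n : nat) (e : 'I_n -> nat) (l : int) : nat :=
  #|[set x : {ffun 'I_n -> 'I_(`|l|%N.+1)} |
      (\sum_(i < n) e i * x i)%N%:Z == l]|.

Definition lcm_all (n : nat) (a : 'I_n -> nat) : nat :=
  \big[lcmn/1%N]_(i < n) a i.

Definition residue (n : nat) (a : 'I_n -> nat) (b : nat) : nat :=
  (b %% lcm_all a)%N.

(* This can be -1, for instance when a = (2, 2), c = (1, 1) and b is odd. *)
Definition sbar (n : nat) (a c : 'I_n -> nat) (b : nat) : int :=
  Num.floor ((\sum_(i < n) c i)%N%:R
             - ((\sum_(i < n) a i)%N + residue a b)%N%:R / (lcm_all a)%:R : rat).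

(* The index tuples i_1 < ... < i_j are the j-element subsets A of 'I_n. *)
Definition mcoef (n : nat) (a c : 'I_n -> nat) (b k : nat) : int :=
  \sum_(j < k.+1) (-1) ^+ j *
    \sum_(A : {set 'I_n} | #|A| == j)
      (nsol a ((residue a b)%:Z + k%:Z * (lcm_all a)%:Z
               - (lcm_all a)%:Z * (\sum_(i in A) c i)%N%:Z))%:Z.

(* \sum_(k = 0)^s F k, which is 0 when s < 0. *)
Definition sum_upto (s : int) (F : nat -> int) : int :=
  if s is Posz m then \sum_(k < m.+1) F k else 0.

Lemma nsolP (n : nat) (e : 'I_n -> nat) (l : int) :
  (forall i, (0 < e i)%N) ->
  exists s : seq {ffun 'I_n -> nat},
    [/\ uniq s,
        forall x, (x \in s) = ((\sum_(i < n) e i * x i)%N%:Z == l)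
      & size s = nsol e l].
Proof.
move=> e_gt0.
pose S := [set x : {ffun 'I_n -> 'I_(`|l|%N.+1)} |
            (\sum_(i < n) e i * x i)%N%:Z == l].
pose f (x : {ffun 'I_n -> 'I_(`|l|%N.+1)}) := [ffun i => nat_of_ord (x i)].
exists [seq f x | x <- enum S]; split; last by rewrite size_map -cardE.
- rewrite map_inj_uniq ?enum_uniq // => x y /ffunP fxy; apply/ffunP => i.
  by apply/val_inj; have := fxy i; rewrite !ffunE.
- move=> y; apply/mapP/eqP => [[x] | yl].
    rewrite mem_enum inE => /eqP xl ->; rewrite -[RHS]xl; congr Posz.
    by apply: eq_bigr => i _; rewrite ffunE.
  have y_le i : (y i < `|l|.+1)%N.
    rewrite ltnS -yl absz_nat (bigD1 i) //=.
    by apply: leq_trans (leq_addr _ _); rewrite leq_pmull.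
  exists [ffun i => Ordinal (y_le i)]; last by apply/ffunP => i; rewrite !ffunE.
  rewrite mem_enum inE -[X in _ == X]yl; apply/eqP; congr Posz.
  by apply: eq_bigr => i _; rewrite ffunE.
Qed.

Lemma mcoef0 (n : nat) (a c : 'I_n -> nat) (b : nat) :
  mcoef a c b 0 = (nsol a (residue a b)%:Z)%:Z.
Proof.
rewrite /mcoef big_ord1 expr0 mul1r (big_pred1 set0) => [|A]; last first.
  by rewrite cards_eq0.
by rewrite big_set0 mulr0 mul0r subr0 addr0.
Qed.

(* Main.v *)
Require Import Defs.
From mathcomp Require Import all_boot all_order all_algebra.
From mathcomp Require Import zify.

Set Implicit Arguments.
Unset Strict Implicit.
Unset Printing Implicit Defensive.

Import Order.TTheory GRing.Theory Num.Theory.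
Local Open Scope ring_scope.

(** Why the formula holds.  The generating series of the number of solutions of
    sum_i a_i x_i = l is prod_i 1 / (1 - X^(a_i)).  Since a_i divides M, there
    is d_i with a_i d_i = M c_i, and

      prod_i 1 / (1 - X^(a_i)) = Q * prod_i 1 / (1 - X^(M c_i)),

      Q = prod_i (1 - X^(M c_i)) / (1 - X^(a_i))
        = prod_i (1 + X^(a_i) + ... + X^(a_i (d_i - 1))).

    The second factor is the generating series of the c_i with X replaced by
    X^M, so that comparing the coefficients of X^b, with b = q M + r, gives

      P(b) = sum_(k <= q) Q_(r + k M) P(sum_i c_i x_i = q - k)

    (nsol_conv).  It remains to see two things.
    - Q_(r + k M) is m_k (mcoefE): expand the numerator of Q by inclusion and
      exclusion.  An index set with more than k elements contributes nothing,
      since its c_i add up to more than k and P vanishes at negative integers.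
    - Q has degree M sum_i c_i - sum_i a_i, so Q_(r + k M) vanishes for
      every k > sbar (mcoef_eq0).

    Power series are avoided by bounding the i-th variable by some d_i: the
    product of the finite geometric sums 1 + X^(e_i) + ... + X^(e_i (d_i - 1))
    has the right coefficients in every degree below all the e_i d_i
    (coef_boxgf), and such truncations still satisfy exact identities between
    polynomials.  Q itself is a product of this kind. *)

(** The coefficient of X^l is the number of solutions of sum_i e_i x_i = l with
    x_i < d_i for all i. *)
Definition boxgf (n : nat) (e d : 'I_n -> nat) : {poly int} :=
  \prod_(i < n) \sum_(j < d i) 'X^(e i) ^+ j.

Section Sums.
Variable V : nmodType.
Implicit Type F : nat -> V.

Lemma sum_ord_extend F m n :
  (m <= n)%N -> (forall k, (m <= k)%N -> F k = 0) ->
  \sum_(k < n) F k = \sum_(k < m) F k.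
Proof.
move=> le_mn F0; rewrite (big_ord_widen _ _ le_mn) [RHS]big_mkcond /=.
by apply: eq_bigr => k _; case: ltnP => // /F0.
Qed.

Lemma sum_ord_support F m n :
  (forall k, (m <= k)%N -> F k = 0) -> (forall k, (n <= k)%N -> F k = 0) ->
  \sum_(k < m) F k = \sum_(k < n) F k.
Proof.
move=> Fm Fn.
by case/orP: (leq_total m n) => le; [symmetry|]; apply: sum_ord_extend.
Qed.

End Sums.

(** The truncation at s is immaterial for a summand supported below both s and
    N. A negative s is covered: the summand is then zero. *)
Lemma sum_upto_support (s : int) (F : nat -> int) N :
  (forall k : nat, s < k%:Z -> F k = 0) -> (forall k, (N <= k)%N -> F k = 0) ->
  sum_upto s F = \sum_(k < N) F k.
Proof.
case: s => s Fs FN /=; first by apply: sum_ord_support => // k; apply: Fs.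
by rewrite big1 // => k _; apply: Fs.
Qed.

Lemma nsol_neg n (e : 'I_n -> nat) (l : int) : l < 0 -> nsol e l = 0%N.
Proof.
by case: l => // l _; rewrite /nsol (_ : [set _ | _] = set0) ?cards0.
Qed.

Section BoxGf.
Variable n : nat.
Implicit Types (e d f : 'I_n -> nat) (p : {poly int}).

Lemma prod_Xn (A : {set 'I_n}) f :
  \prod_(i in A) 'X^(f i) = 'X^(\sum_(i in A) f i) :> {poly int}.
Proof. by rewrite (big_morph _ (exprD _) (expr0 _)). Qed.

Lemma prod_1subXn f :
  \prod_(i < n) (1 - 'X^(f i)) =
  \sum_(A : {set 'I_n}) (-1) ^+ #|A| *: 'X^(\sum_(i in A) f i) :> {poly int}.
Proof.
under eq_bigr do rewrite addrC.
rewrite bigA_distr; apply: eq_bigr => A _.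
rewrite -prod_Xn -big_mkcond /= prodrN -signr_odd -[in RHS]signr_odd.
by rewrite scaler_sign -mulr_sign.
Qed.

(** Congruence modulo X^(l+1) in the only form needed: factors 1 - X^m with
    m > l do not affect the coefficient of X^l. *)
Lemma coef_mul_1subXn p f l :
  (forall i, (l < f i)%N) -> (p * \prod_(i < n) (1 - 'X^(f i)))`_l = p`_l.
Proof.
move=> lt_lf; elim/big_rec: _ => [|i q _ IHq]; first by rewrite mulr1.
by rewrite mulrCA mulrBl mul1r coefB coefXnM lt_lf subr0.
Qed.

Lemma boxgf_mul e d :
  boxgf e d * \prod_(i < n) (1 - 'X^(e i)) =
  \prod_(i < n) (1 - 'X^(e i * d i)).
Proof.
rewrite -big_split /=; apply: eq_bigr => i _.
by rewrite exprM -[RHS]opprB subrX1 -mulNr opprB mulrC.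
Qed.

(** Both sides become the product of all 1 - X^(e_i d_i) and 1 - X^(e_i d'_i)
    over the 1 - X^(e_i).  Modulo a power of X, this compares two ways of
    bounding the variables. *)
Lemma boxgf_swap e d d' :
  boxgf e d * \prod_(i < n) (1 - 'X^(e i * d' i)) =
  boxgf e d' * \prod_(i < n) (1 - 'X^(e i * d i)).
Proof. by rewrite -!boxgf_mul mulrCA. Qed.

(** Writing x_i < d_i d'_i as x_i = z_i + d_i y_i with z_i < d_i and y_i < d'_i;
    proved by cancelling the factors 1 - X^(e_i) rather than by a bijection. *)
Lemma boxgf_mixed_radix e d d' :
  (forall i, 0 < e i)%N ->
  boxgf e (fun i => d i * d' i)%N =
  boxgf e d * boxgf (fun i => e i * d i)%N d'.
Proof.
move=> e_gt0; pose D := \prod_(i < n) (1 - 'X^(e i)) : {poly int}.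
have D_neq0 : D != 0.
  apply/prodf_neq0 => i _; apply/eqP => /(congr1 (fun p : {poly int} => p`_0)).
  rewrite coefB coef1 coefXn coef0 (ltn_eqF (e_gt0 i)) subr0.
  by move/eqP; rewrite oner_eq0.
apply: (mulIf D_neq0); rewrite boxgf_mul mulrAC boxgf_mul mulrC boxgf_mul.
by apply: eq_bigr => i _; rewrite mulnA.
Qed.

Lemma boxgf_comp_Xn e d m :
  boxgf (fun i => m * e i)%N d = boxgf e d \Po 'X^m.
Proof.
rewrite /boxgf rmorph_prod /=; apply: eq_bigr => i _.
rewrite rmorph_sum /=; apply: eq_bigr => j _.
by rewrite !rmorphXn /= comp_polyX -!exprM mulnA.
Qed.

Lemma size_boxgf e d :
  (forall i, 0 < d i)%N ->
  (size (boxgf e d) + \sum_(i < n) e i <= (\sum_(i < n) e i * d i).+1)%N.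
Proof.
move=> d_gt0; rewrite /boxgf.
elim/big_rec3: _ => [|i s t p _ IH]; first by rewrite size_poly1.
have := size_polyMleq (\sum_(j < d i) 'X^(e i) ^+ j) p.
have : (size (\sum_(j < d i) 'X^(e i) ^+ j : {poly int})%R
          <= (e i * (d i).-1).+1)%N.
  apply: leq_trans (size_sum _ _ _) _; apply/bigmax_leqP => j _.
  by rewrite -exprM size_polyXn ltnS leq_mul2l -ltnS prednK ?ltn_ord ?orbT.
have : (e i * d i = e i * (d i).-1 + e i)%N by rewrite -mulnSr prednK.
lia.
Qed.

Lemma coef_boxgf_diag e l :
  (boxgf e (fun=> l.+1))`_l = (nsol e l%:Z)%:Z.
Proof.
rewrite /boxgf bigA_distr_bigA /= coef_sum /nsol -sum1dep_card.
rewrite (big_morph Posz PoszD (erefl _)) [RHS]big_mkcond /=.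
apply: eq_bigr => x _.
under eq_bigr do rewrite -exprM.
rewrite -(big_morph _ (exprD _) (expr0 _)) coefXn eq_sym eqz_nat.
by case: eqP.
Qed.

(** A solution of sum_i e_i x_i = l has e_i x_i <= l < e_i d_i, so the bounds
    x_i < d_i lose nothing.  In the proof, this is read off from the
    comparison with the bounds x_i < l + 1 in boxgf_swap. *)
Lemma coef_boxgf e d l :
  (forall i, 0 < e i)%N -> (forall i, l < e i * d i)%N ->
  (boxgf e d)`_l = (nsol e l%:Z)%:Z.
Proof.
move=> e_gt0 lt_l; rewrite -coef_boxgf_diag.
rewrite -(@coef_mul_1subXn (boxgf e d) (fun i => e i * l.+1)%N); last first.
  by move=> i; rewrite leq_pmull.
by rewrite boxgf_swap // coef_mul_1subXn.
Qed.

(** Inclusion and exclusion over the set A of variables that violate the bound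
    x_i < d_i: subtracting d_i from those variables lowers the right-hand side
    by the sum of the e_i d_i. *)
Lemma coef_boxgf_incl_excl e d l :
  (forall i, 0 < e i)%N -> (forall i, 0 < d i)%N ->
  (boxgf e d)`_l =
  \sum_(A : {set 'I_n}) (-1) ^+ #|A| *
    (nsol e (l%:Z - (\sum_(i in A) e i * d i)%N%:Z))%:Z.
Proof.
move=> e_gt0 d_gt0.
rewrite -(@coef_mul_1subXn _ (fun i => e i * l.+1)%N); last first.
  by move=> i; rewrite leq_pmull.
(* The swap gives the series prod_i 1 / (1 - X^(e_i)), truncated above degree l,
   times the numerator prod_i (1 - X^(e_i d_i)). *)
rewrite boxgf_swap // prod_1subXn mulr_sumr coef_sum.
apply: eq_bigr => A _; rewrite -scalerAr coefZ coefMXn.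
set s := (\sum_(i in A) _)%N; congr (_ * _).
case: ltnP => [lt_ls | le_sl]; first by rewrite nsol_neg // subr_lt0.
rewrite subzn // coef_boxgf // => i.
by apply: leq_ltn_trans (leq_subr _ _) _; rewrite leq_pmull.
Qed.

End BoxGf.

Lemma sum_by_card n (F : {set 'I_n} -> int) k :
  (forall A : {set 'I_n}, (k < #|A|)%N -> F A = 0) ->
  \sum_(A : {set 'I_n}) (-1) ^+ #|A| * F A =
  \sum_(j < k.+1) (-1) ^+ j * \sum_(A : {set 'I_n} | #|A| == j) F A.
Proof.
move=> F0; rewrite (bigID (fun A : {set 'I_n} => (#|A| < k.+1)%N)) /=.
rewrite [X in _ + X]big1 => [|A]; last first.
  by rewrite -leqNgt => /F0->; rewrite mulr0.
pose card_ord (A : {set 'I_n}) : 'I_k.+1 := inord #|A|.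
rewrite addr0 (partition_big card_ord predT) //=; apply: eq_bigr => j _.
rewrite mulr_sumr; apply: eq_big => [A | A /andP[lt_Ak]]; rewrite /card_ord.
  apply/andP/eqP => [[lt_Ak /eqP <-] | eq_Aj]; first by rewrite inordK.
  by rewrite eq_Aj ltn_ord inord_val.
by move/eqP <-; rewrite inordK.
Qed.

(** Only the exponents m t with t <= b %/ m contribute, and with
    k = b %/ m - t the complementary exponent is b - m t = b %% m + k m. *)
Lemma coef_mul_comp_Xn (p q : {poly int}) m b : (0 < m)%N ->
  (p * (q \Po 'X^m))`_b =
  \sum_(k < (b %/ m).+1) p`_(b %% m + k * m) * q`_(b %/ m - k).
Proof.
move=> m_gt0; rewrite comp_polyE mulr_sumr coef_sum.
pose F t := q`_t * (if (b < m * t)%N then 0 else p`_(b - m * t)).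
transitivity (\sum_(t < size q) F t).
  by apply: eq_bigr => t _; rewrite -scalerAr coefZ -exprM coefMXn.
have F_size t : (size q <= t)%N -> F t = 0.
  by move=> le_t; rewrite /F nth_default ?mul0r.
have F_quo t : (b %/ m < t)%N -> F t = 0.
  by rewrite ltn_divLR // mulnC /F => ->; rewrite mulr0.
rewrite (sum_ord_support F_size F_quo).
rewrite (reindex_inj rev_ord_inj) /=; apply: eq_bigr => k _.
have le_k : (k <= b %/ m)%N by rewrite -ltnS.
have eq_b := divn_eq b m.
rewrite /F subSS mulrC mulnC mulnBl.
have le_km : (k * m <= b %/ m * m)%N by rewrite leq_mul2r le_k orbT.
rewrite ltnNge (_ : (_ <= b)%N) /=; last by lia.
by congr (p`_ _ * _); lia.
Qed.

Section Decomposition.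
Variables (n : nat) (a c : 'I_n -> nat).
Hypotheses (ha : forall i, (0 < a i)%N) (hc : forall i, (0 < c i)%N).
Local Notation M := (lcm_all a).
(* The d_i with a_i d_i = M c_i. *)
Local Notation d := (fun i => M %/ a i * c i)%N.

Lemma lcm_all_gt0 : (0 < M)%N.
Proof.
by rewrite /lcm_all; elim/big_ind: _ => // x y; rewrite lcmn_gt0 => -> ->.
Qed.

Lemma dvdn_lcm_all i : (a i %| M)%N.
Proof. by rewrite /lcm_all (bigD1 i) //= dvdn_lcml. Qed.

Lemma mul_quo i : (a i * d i = M * c i)%N.
Proof. by rewrite mulnA [(a i * _)%N]mulnC divnK // dvdn_lcm_all. Qed.

Lemma quo_gt0 i : (0 < d i)%N.
Proof.
by rewrite muln_gt0 hc divn_gt0 // dvdn_leq ?lcm_all_gt0 ?dvdn_lcm_all.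
Qed.

Lemma mcoefE b k : mcoef a c b k = (boxgf a d)`_(residue a b + k * M).
Proof.
rewrite (coef_boxgf_incl_excl _ ha quo_gt0) /mcoef.
rewrite (sum_by_card (k := k)) => [|A lt_kA].
  apply: eq_bigr => j _; congr (_ * _); apply: eq_bigr => A _.
  congr (Posz (nsol _ _)); rewrite PoszD PoszM; congr (_ - _).
  rewrite -PoszM big_distrr; congr Posz.
  by apply: eq_bigr => i _; rewrite mul_quo.
(* For #|A| > k, M * \sum_(i in A) c i >= (k + 1) * M > r + k * M. *)
rewrite nsol_neg // subr_lt0 ltz_nat.
apply: (@leq_trans (k.+1 * M)).
  by rewrite mulSn ltn_add2r ltn_mod lcm_all_gt0.
under eq_bigr do rewrite mul_quo.
rewrite -big_distrr /= mulnC leq_mul2l; apply/orP; right.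
by apply: leq_trans lt_kA _; rewrite -sum1_card leq_sum.
Qed.

(** For k > sbar, the exponent r + k M exceeds the degree
    M * \sum_i c i - \sum_i a i of the polynomial in mcoefE. *)
Lemma mcoef_eq0 b k : sbar a c b < k%:Z -> mcoef a c b k = 0.
Proof.
have M_gt0 : 0 < M%:R :> rat by rewrite ltr0n lcm_all_gt0.
rewrite /sbar floor_lt_int ltrBlDr -ltrBlDl ltr_pdivlMr // mulrBl ltrBlDr.
rewrite -!natrM -natrD ltr_nat => lt_k; rewrite mcoefE nth_default //.
have := size_boxgf a quo_gt0.
under [X in (_ <= X.+1)%N]eq_bigr do rewrite mul_quo.
rewrite -big_distrr /= mulnC => le_size.
by rewrite -(leq_add2r (\sum_(i < n) a i)) (leq_trans le_size) // addnC addnA.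
Qed.

Lemma nsol_conv b :
  (nsol a b%:Z)%:Z =
  \sum_(k < (b %/ M).+1) mcoef a c b k * (nsol c ((b %/ M)%N%:Z - k%:Z))%:Z.
Proof.
(* The factor b + 1 makes a_i d_i (b + 1) > b, so that no solution is lost, and
   d_i makes the mixed radix decomposition split off Q exactly. *)
rewrite -(@coef_boxgf _ a (fun i => d i * b.+1)%N) // => [|i]; last first.
  by rewrite mulnA mul_quo leq_pmull // muln_gt0 lcm_all_gt0 hc.
rewrite boxgf_mixed_radix //.
rewrite (_ : boxgf _ (fun=> b.+1) = boxgf c (fun=> b.+1) \Po 'X^M).
  rewrite coef_mul_comp_Xn ?lcm_all_gt0 //; apply: eq_bigr => k _.
  have le_k : (k <= b %/ M)%N by rewrite -ltnS.
  rewrite mcoefE subzn // [(boxgf c _)`_ _]coef_boxgf // => i.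
  apply: (@leq_trans b.+1); last by rewrite leq_pmull.
  by rewrite ltnS (leq_trans (leq_subr _ _)) // leq_div.
by rewrite -boxgf_comp_Xn; apply: eq_bigr => i _; rewrite mul_quo.
Qed.

End Decomposition.

Theorem theorem2p2 (n : nat) (hn : (2 <= n)%N) (a c : 'I_n -> nat)
  (ha : forall i : 'I_n, (0 < a i)%N) (hc : forall i : 'I_n, (0 < c i)%N)
  (b : nat) :
  (nsol a b%:Z)%:Z =
  sum_upto (sbar a c b) (fun k : nat =>
    mcoef a c b k * (nsol c ((b %/ lcm_all a)%N%:Z - k%:Z))%:Z).
Proof.
rewrite (nsol_conv ha hc); symmetry.
apply: sum_upto_support => [k lt_sk | k lt_qk].
  by rewrite mcoef_eq0 ?mul0r.
by rewrite nsol_neg ?mulr0 // subr_lt0 ltz_nat.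
Qed.
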